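(* Let $n$ be a positive integer and $\mathbf{k}=(k_1,\dots,k_m)$ an index (tuple of positive integers). Then the following functional equation holds in $\mathcal{A}_{n,\mathbb{Z}[t_1,\dots,t_m]}$: $$\sum_{j=0}^{m}(-1)^j\,\pounds^{\ast}_{\mathcal{A}_n,(k_1,\dots,k_j)}(t_1,\dots,t_j)\,\pounds^{\ast,\star}_{\mathcal{A}_n,(k_m,k_{m-1},\dots,k_{j+1})}(t_m,t_{m-1},\dots,t_{j+1})=0,$$ where $\pounds^{\ast}_{\mathcal{A}_n,(k_1,\dots,k_j)}(t_1,\dots,t_j)$ is taken to be $1$ when $j=0$, and $\pounds^{\ast,\star}_{\mathcal{A}_n,(k_m,\dots,k_{j+1})}(t_m,\dots,t_{j+1})$ is taken to be $1$ when $j=m$.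
   Context: For a commutative ring $R$, $\mathcal{A}_{n,R}=\left(\prod_pR/p^nR\right)/\left(\bigoplus_pR/p^nR\right)$, $p$ running over all primes; elements are written $(a_p)_p$, and two are equal iff their components agree for all but finitely many $p$. For an index $(k_1,\dots,k_r)$, the finite harmonic (star-)multiple polylogarithms are $$\pounds^{\ast}_{\mathcal{A}_n,(k_1,\dots,k_r)}(t_1,\dots,t_r)=\Bigl(\sum_{p>n_1>\cdots>n_r>0}\frac{t_1^{n_1}\cdots t_r^{n_r}}{n_1^{k_1}\cdots n_r^{k_r}}\bmod p^n\Bigr)_p,$$ $$\pounds^{\ast,\star}_{\mathcal{A}_n,(k_1,\dots,k_r)}(t_1,\dots,t_r)=\Bigl(\sum_{p-1\ge n_1\ge\cdots\ge n_r\ge1}\frac{t_1^{n_1}\cdots t_r^{n_r}}{n_1^{k_1}\cdots n_r^{k_r}}\bmod p^n\Bigr)_p.$$ *)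

(* Defs.v *)
From HB Require Import structures.
From mathcomp Require Import all_boot all_algebra.
From mathcomp Require Import boolp classical_sets cardinality.
From mathcomp Require Import mpoly.

Set Implicit Arguments.
Unset Strict Implicit.
Unset Printing Implicit Defensive.

Import GRing.Theory.

Local Open Scope ring_scope.
Local Open Scope quotient_scope.

(* MathComp only provides quotients by proper ideals ({ideal_quot _}), whereas
   R / p^n R may be the zero ring for a general R.  We therefore put a ring
   structure, possibly trivial, on the quotient by an arbitrary ideal. *)

HB.mixin Record isMulAbsorbing (R : comPzRingType) (I : R -> bool) := {
  mul_absorbing : forall a u : R, u \in I -> a * u \in I
}.

#[short(type="anyIdeal")]
HB.structure Definition AnyIdeal (R : comPzRingType) :=
  {I of GRing.ZmodClosed R I & isMulAbsorbing R I}.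

Definition quotRing (R : comPzRingType) (I : anyIdeal R) : Type :=
  Quotient.quot I.

Section QuotRing.
Variables (R : comPzRingType) (I : anyIdeal R).

HB.instance Definition _ := GRing.Zmodule.on (quotRing I).
HB.instance Definition _ :=
  ZmodQuotient.copy (quotRing I) (Quotient.quot I).

Local Notation Q := (quotRing I).

Lemma quotRing_eqE (x y : R) : (\pi_Q x == \pi_Q y) = (x - y \in I).
Proof. by rewrite -[RHS]/(Quotient.equiv I x y) piE. Qed.

Lemma pi_surj (x : Q) : exists y : R, x = \pi_Q y.
Proof. by exists (repr x); rewrite reprK. Qed.

Lemma quotRing_piB (x y : R) : \pi_Q (x - y) = \pi_Q x - \pi_Q y.
Proof. exact: (raddfB \pi_Q). Qed.

Lemma quotRing_piD (x y : R) : \pi_Q (x + y) = \pi_Q x + \pi_Q y.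
Proof. exact: (raddfD \pi_Q). Qed.

Definition quot_one : Q := \pi_Q 1.
Definition quot_mul (x y : Q) : Q := \pi_Q (repr x * repr y).

Lemma pi_quot_mul (x y : R) : \pi_Q (x * y) = quot_mul (\pi_Q x) (\pi_Q y).
Proof.
set x' := repr (\pi_Q x); set y' := repr (\pi_Q y).
have hx : x - x' \in I by rewrite -quotRing_eqE reprK.
have hy : y - y' \in I by rewrite -quotRing_eqE reprK.
apply/eqP; rewrite quotRing_eqE -/x' -/y'.
have -> : x * y - x' * y' = y * (x - x') + x' * (y - y').
  by rewrite !mulrBr (mulrC y x) (mulrC y x') addrA subrK.
by apply: rpredD; apply: mul_absorbing.
Qed.

Lemma quot_mulA : associative quot_mul.
Proof.
move=> x y z.
case: (pi_surj x) (pi_surj y) (pi_surj z) => a -> [b ->] [c ->].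
by rewrite -!pi_quot_mul mulrA.
Qed.

Lemma quot_mulC : commutative quot_mul.
Proof.
by move=> x y; case: (pi_surj x) (pi_surj y) => a -> [b ->]; rewrite -!pi_quot_mul mulrC.
Qed.

Lemma quot_mul1 : left_id quot_one quot_mul.
Proof. by move=> x; case: (pi_surj x) => a ->; rewrite -pi_quot_mul mul1r. Qed.

Lemma quot_mulDl : left_distributive quot_mul +%R.
Proof.
move=> x y z.
case: (pi_surj x) (pi_surj y) (pi_surj z) => a -> [b ->] [c ->].
by rewrite -quotRing_piD -!pi_quot_mul mulrDl quotRing_piD.
Qed.

HB.instance Definition _ :=
  GRing.Zmodule_isComPzRing.Build Q quot_mulA quot_mulC quot_mul1 quot_mulDl.

Definition quot_proj (x : R) : Q := \pi_Q x.

Lemma quot_proj_zmod_morphism : zmod_morphism quot_proj.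
Proof. exact: quotRing_piB. Qed.

Lemma quot_proj_monoid_morphism : monoid_morphism quot_proj.
Proof. by split=> // x y; exact: pi_quot_mul. Qed.

HB.instance Definition _ :=
  GRing.isZmodMorphism.Build R Q quot_proj quot_proj_zmod_morphism.
HB.instance Definition _ :=
  GRing.isMonoidMorphism.Build R Q quot_proj quot_proj_monoid_morphism.

Lemma quot_projP (x y : R) : quot_proj x = quot_proj y <-> x - y \in I.
Proof. by rewrite -quotRing_eqE; split=> /eqP. Qed.

End QuotRing.

Arguments quot_proj {R} I x.

Definition dprodRing (T : Type) (R : T -> comPzRingType) : Type :=
  forall t, R t.

Section ProductRing.
Variables (T : Type) (R : T -> comPzRingType).

Local Notation P := (dprodRing R).

HB.instance Definition _ := Choice.copy P (forall t, R t).

Implicit Types a b c : P.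

Definition dprod_zero : P := fun=> 0.
Definition dprod_one : P := fun=> 1.
Definition dprod_opp a : P := fun t => - a t.
Definition dprod_add a b : P := fun t => a t + b t.
Definition dprod_mul a b : P := fun t => a t * b t.

Lemma dprod_addA : associative dprod_add.
Proof. by move=> a b c; apply: functional_extensionality_dep => t; apply: addrA. Qed.
Lemma dprod_addC : commutative dprod_add.
Proof. by move=> a b; apply: functional_extensionality_dep => t; apply: addrC. Qed.
Lemma dprod_add0 : left_id dprod_zero dprod_add.
Proof. by move=> a; apply: functional_extensionality_dep => t; apply: add0r. Qed.
Lemma dprod_addN : left_inverse dprod_zero dprod_opp dprod_add.
Proof. by move=> a; apply: functional_extensionality_dep => t; apply: addNr. Qed.

HB.instance Definition _ :=
  GRing.isZmodule.Build P dprod_addA dprod_addC dprod_add0 dprod_addN.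

Lemma dprod_mulA : associative dprod_mul.
Proof. by move=> a b c; apply: functional_extensionality_dep => t; apply: mulrA. Qed.
Lemma dprod_mulC : commutative dprod_mul.
Proof. by move=> a b; apply: functional_extensionality_dep => t; apply: mulrC. Qed.
Lemma dprod_mul1 : left_id dprod_one dprod_mul.
Proof. by move=> a; apply: functional_extensionality_dep => t; apply: mul1r. Qed.
Lemma dprod_mulDl : left_distributive dprod_mul +%R.
Proof. by move=> a b c; apply: functional_extensionality_dep => t; apply: mulrDl. Qed.

HB.instance Definition _ := GRing.Zmodule_isComPzRing.Build P
  dprod_mulA dprod_mulC dprod_mul1 dprod_mulDl.

Definition dsum : pred P := fun a => `[< finite_set [set t | a t <> 0]%classic >].

Lemma dsum_zmod_closed : zmod_closed dsum.
Proof.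
split=> [|a b /asboolP fa /asboolP fb]; apply/asboolP.
  by rewrite (_ : [set _ | _]%classic = set0%classic)//; apply/seteqP; split=> t.
apply: (@sub_finite_set _ _
  ([set t | a t <> 0]%classic `|` [set t | b t <> 0]%classic)%classic); last first.
  by rewrite finite_setU.
move=> t /= h; have [a0|] := pselect (a t = 0); last by left.
by right=> b0; apply: h; rewrite -[LHS]/(a t - b t) a0 b0 subr0.
Qed.

Lemma dsum_mul (a u : P) : u \in dsum -> a * u \in dsum.
Proof.
move=> /asboolP fu; apply/asboolP; apply: sub_finite_set fu => t /= h u0.
by apply: h; rewrite -[LHS]/(a t * u t) u0 mulr0.
Qed.

HB.instance Definition _ := GRing.isZmodClosed.Build P dsum dsum_zmod_closed.
HB.instance Definition _ := isMulAbsorbing.Build P dsum dsum_mul.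

Definition dsum_ideal : anyIdeal P := AnyIdeal.clone P dsum _.

End ProductRing.

Section PrincipalIdeal.
Variables (R : comPzRingType) (d : R).

Definition principal : pred R := fun x => `[< exists y, x = d * y >].

Lemma principal_zmod_closed : zmod_closed principal.
Proof.
split=> [|x y /asboolP[u ->] /asboolP[v ->]]; apply/asboolP.
  by exists 0; rewrite mulr0.
by exists (u - v); rewrite mulrBr.
Qed.

Lemma principal_mul (a u : R) : u \in principal -> a * u \in principal.
Proof.
by move=> /asboolP[y ->]; apply/asboolP; exists (a * y); rewrite mulrCA.
Qed.

HB.instance Definition _ :=
  GRing.isZmodClosed.Build R principal principal_zmod_closed.
HB.instance Definition _ := isMulAbsorbing.Build R principal principal_mul.

Definition principal_ideal : anyIdeal R := AnyIdeal.clone R principal _.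

End PrincipalIdeal.

Definition primeNat := {p : nat | prime p}.

(* R / p^n R *)
Definition modpn (n : nat) (R : comPzRingType) (p : primeNat) : comPzRingType :=
  quotRing (principal_ideal ((val p ^ n)%N%:R : R)).

Definition to_modpn (n : nat) (R : comPzRingType) (p : primeNat) :
  {rmorphism R -> modpn n R p} := quot_proj _.

(* A_{n,R} = (prod_p R / p^n R) / (direct sum of the R / p^n R) *)
Definition calA (n : nat) (R : comPzRingType) : comPzRingType :=
  quotRing (dsum_ideal (modpn n R)).

(* The class (a_p)_p *)
Definition classA (n : nat) (R : comPzRingType)
  (a : forall p, modpn n R p) : calA n R := quot_proj (dsum_ideal (modpn n R)) a.

Lemma classA_eqP (n : nat) (R : comPzRingType) (a b : forall p, modpn n R p) :
  classA a = classA b <-> finite_set [set p | a p <> b p]%classic.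
Proof.
rewrite /classA quot_projP; split=> [/asboolP|] h; last apply/asboolP.
  by apply: sub_finite_set h => p /= ab /subr0_eq.
apply: sub_finite_set h => p /= ab e; apply: ab.
by rewrite -[LHS]/(a p - b p) e subrr.
Qed.

(* MathComp's unit rings are nontrivial, so x^-1 is not available on a possibly
   zero ring.  The value is irrelevant when x is not invertible. *)
Definition pzinv (S : comPzRingType) (x : S) : S := xget 0 [set y | x * y = 1]%classic.

Lemma pzinvE (S : comPzRingType) (x y : S) : x * y = 1 -> pzinv x = y.
Proof.
move=> xy; rewrite /pzinv; case: xgetP => [z _ /= xz|/(_ y)//].
by rewrite -[z]mulr1 -xy mulrA [z * x]mulrC xz mul1r.
Qed.

(* The denominators n_i^{k_i} occurring below are invertible in R / p^n R. *)
Lemma modpn_inv (n : nat) (R : comPzRingType) (p : primeNat) (d : nat) :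
  (0 < d < val p)%N -> (d%:R : modpn n R p) * pzinv d%:R = 1.
Proof.
case/andP=> d0 dp.
have cop : coprime d (val p ^ n).
  rewrite coprimeXr // coprime_sym prime_coprime ?(valP p) //.
  by apply/negP => /(dvdn_leq d0); rewrite leqNgt dp.
have pn0 : ((val p ^ n)%N%:R : modpn n R p) = 0.
  rewrite -(rmorph_nat (to_modpn n R p)) -(rmorph0 (to_modpn n R p)).
  by apply/quot_projP; apply/asboolP; exists 1; rewrite subr0 mulr1.
case: (egcdnP (val p ^ n) d0) => u v e _.
have {}e : ((d%:R : modpn n R p) * u%:R = 1).
  by rewrite mulrC -natrM e natrD (eqP cop) natrM pn0 mulr0 add0r.
by rewrite (pzinvE e).
Qed.

Section FinitePolylog.
Variables (n : nat) (R : comPzRingType) (r : nat).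
Variables (k : r.-tuple nat) (t : r.-tuple R).

Definition polylog_term (p : primeNat) (s : r.-tuple 'I_(val p)) :
  modpn n R p :=
  \prod_(i < r) (to_modpn n R p (tnth t i ^+ tnth s i)
                 * pzinv ((tnth s i)%:R ^+ tnth k i)).

(* The bound s_i < p is carried by the type 'I_p. *)
Definition fpolylog : calA n R := classA (fun p : primeNat =>
  \sum_(s : r.-tuple 'I_(val p)
         | [forall i, 0 < tnth s i]%N && sorted gtn (map val s))
    polylog_term s).

Definition fpolylog_star : calA n R := classA (fun p : primeNat =>
  \sum_(s : r.-tuple 'I_(val p)
         | [forall i, 0 < tnth s i]%N && sorted geq (map val s))
    polylog_term s).

End FinitePolylog.

Lemma fpolylog0 (n : nat) (R : comPzRingType) (k : 0.-tuple nat)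
  (t : 0.-tuple R) : fpolylog n k t = 1.
Proof.
apply/classA_eqP; rewrite (_ : [set _ | _]%classic = set0%classic)//.
apply/seteqP; split=> p //= h; apply: h.
rewrite (big_pred1 [tuple]); first by rewrite /polylog_term big_ord0.
move=> s; rewrite [s]tuple0 [RHS]eqxx andbT.
by apply/forallP => -[].
Qed.

Lemma fpolylog_star0 (n : nat) (R : comPzRingType) (k : 0.-tuple nat)
  (t : 0.-tuple R) : fpolylog_star n k t = 1.
Proof.
apply/classA_eqP; rewrite (_ : [set _ | _]%classic = set0%classic)//.
apply/seteqP; split=> p //= h; apply: h.
rewrite (big_pred1 [tuple]); first by rewrite /polylog_term big_ord0.
move=> s; rewrite [s]tuple0 [RHS]eqxx andbT.
by apply/forallP => -[].
Qed.

(* Main.v *)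
Require Import Defs.
From HB Require Import structures.
From mathcomp Require Import all_boot all_algebra.
From mathcomp Require Import boolp.
From mathcomp Require Import mpoly.

(** The identity already holds for every prime [p], before passing to the
    quotient by the direct sum, and over any coefficient ring.  Fix [p] and
    expand the products: the [j]-th summand becomes [(-1)^j] times the sum, over
    all words [s = s_1 ... s_m] in the letters [1, ..., p-1], of one and the same
    weight [prod_i t_i^(s_i) / s_i^(k_i)], restricted to the words with
    [s_1 > ... > s_j] and [s_(j+1) <= ... <= s_m].  (The star sum runs through
    the indices backwards, so its word has to be reversed; this turns a
    nonincreasing condition into a nondecreasing one.)

    Hence it is enough that for each nonempty word the signed number of such
    cutting points [j] vanishes ([alternating_cuts]).  The cuts cancel in pairs:
    a word that strictly decreases up to its minimum and then weakly increases
    can be cut just before or just after the last letter of its decreasing part,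
    and these two cuts have opposite signs; any other word has no admissible cut.
    The proof of this by induction on the word uses only that [>] and [<=] are
    complementary relations. *)

Import GRing.Theory.

Local Open Scope ring_scope.

Section AlternatingCuts.
Context {T : Type} (e : rel T) (S : comPzRingType).

Local Notation ne := (fun x y => ~~ e x y).

(** Putting a letter [x] in front that always belongs to the first part is what
    makes the induction go through.  For a word [y :: s], the cut before [y]
    contributes [path ne y s], and the cuts after [y] contribute, by induction,
    [- e x y] times the same quantity; so [1 - e x y], which is [ne x y],
    factors out. *)
Lemma alternating_cuts_path (x : T) (s : seq T) :
  \sum_(0 <= j < (size s).+1)
    (-1) ^+ j * (path e x (take j s) && sorted ne (drop j s))%:R
  = (path ne x s)%:R :> S.
Proof.
elim: s x => [|y s IHs] x; first by rewrite big_nat1 /= expr0 mul1r.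
rewrite big_nat_recl //= expr0 mul1r.
under eq_bigr => j _ do rewrite exprS mulN1r mulNr -andbA.
rewrite sumrN; case: (e x y) => /=; first by rewrite IHs subrr.
by rewrite big1 ?subr0 // => j _; rewrite mulr0.
Qed.

Lemma alternating_cuts (s : seq T) : (0 < size s)%N ->
  \sum_(0 <= j < (size s).+1)
    (-1) ^+ j * (sorted e (take j s) && sorted ne (drop j s))%:R = 0 :> S.
Proof.
case: s => // x s _; rewrite big_nat_recl //= expr0 mul1r.
under eq_bigr => j _ do rewrite exprS mulN1r mulNr.
by rewrite sumrN alternating_cuts_path subrr.
Qed.

End AlternatingCuts.

Section WordSums.
Context {T : finType} {S : comPzRingType}.

(** The summand is a function of the underlying sequence, so that the length of
    the words can be rewritten without casts between tuple types. *)
Definition word_sum (r : nat) (F : seq T -> S) : S := \sum_(s : r.-tuple T) F s.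

Lemma word_sum_rev r (F : seq T -> S) :
  word_sum r F = word_sum r (fun s => F (rev s)).
Proof.
rewrite /word_sum (reindex_inj (h := fun s : r.-tuple T => [tuple of rev s])) //.
by apply: (can_inj (g := fun s : r.-tuple T => [tuple of rev s])) => s;
   apply/val_inj; rewrite /= revK.
Qed.

Lemma word_sumM a b (F G : seq T -> S) :
  word_sum a F * word_sum b G
  = word_sum (a + b) (fun s => F (take a s) * G (drop a s)).
Proof.
rewrite /word_sum big_distrlr pair_big /=.
pose cut (s : (a + b).-tuple T) : a.-tuple T * b.-tuple T :=
  (tcast (minn_idPl (leq_addr b a)) [tuple of take a s],
   tcast (addKn a b) [tuple of drop a s]).
rewrite (reindex cut) /=.
  by apply: eq_bigr => s _; rewrite !val_tcast.
exists (fun uv : a.-tuple T * b.-tuple T => [tuple of uv.1 ++ uv.2]) => [s|[u v]] _.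
  by apply/val_inj; rewrite /= !val_tcast /= cat_take_drop.
by rewrite /cut; congr pair; apply/val_inj; rewrite /= val_tcast /=
   ?take_size_cat ?drop_size_cat ?size_tuple.
Qed.

End WordSums.

Section Components.
Context (n : nat) (R : comPzRingType) (p : primeNat).

Local Notation S := (modpn n R p).

Definition word_weight (k : seq nat) (t : seq R) (s : seq 'I_(val p)) : S :=
  \prod_(z <- zip (zip k t) s)
    (to_modpn n R p (z.1.2 ^+ z.2) * pzinv (z.2%:R ^+ z.1.1)).

Lemma polylog_termE r (k : r.-tuple nat) (t : r.-tuple R)
    (s : r.-tuple 'I_(val p)) :
  polylog_term n k t s = word_weight k t s.
Proof.
rewrite /polylog_term /word_weight.
rewrite (big_tuple _ _ (zip_tuple (zip_tuple k t) s)) /=.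
apply: eq_bigr => i _; rewrite !(tnth_nth (0%N, 0 : R, tnth s i)) /=.
rewrite !nth_zip ?size_zip ?size_tuple ?minnn //=.
by rewrite -!tnth_nth.
Qed.

Lemma word_weight_rev k t s : size k = size s -> size t = size s ->
  word_weight (rev k) (rev t) (rev s) = word_weight k t s.
Proof.
by move=> ks ts; rewrite /word_weight -!rev_zip ?big_rev ?size_zip ?ks ?ts ?minnn.
Qed.

Lemma word_weight_cut j k t s : size k = size s -> size t = size s ->
  word_weight (take j k) (take j t) (take j s)
    * word_weight (drop j k) (drop j t) (drop j s)
  = word_weight k t s.
Proof.
move=> ks ts; rewrite /word_weight -big_cat -!zip_cat ?cat_take_drop //.
  by rewrite !size_take ts ks.
by rewrite size_zip !size_take ts ks minnn.
Qed.

Definition positive_word (s : seq 'I_(val p)) : bool :=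
  all (fun i : 'I_(val p) => 0 < i)%N s.

Definition descends : rel 'I_(val p) := relpre val gtn.

Definition polylog_component (k : seq nat) (t : seq R) (s : seq 'I_(val p)) : S :=
  (positive_word s && sorted descends s)%:R * word_weight k t s.

Definition polylog_star_component (k : seq nat) (t : seq R)
    (s : seq 'I_(val p)) : S :=
  (positive_word s && sorted (relpre val geq) s)%:R * word_weight k t s.

Lemma polylog_componentE r (k : r.-tuple nat) (t : r.-tuple R) :
  \sum_(s : r.-tuple 'I_(val p)
         | [forall i, 0 < tnth s i]%N && sorted gtn (map val s))
    polylog_term n k t s
  = word_sum r (polylog_component k t).
Proof.
rewrite big_mkcond; apply: eq_bigr => s _.
rewrite polylog_termE /polylog_component /positive_word -forallb_tnth sorted_map.
by case: ifP => _; rewrite ?mul1r ?mul0r.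
Qed.

Lemma polylog_star_componentE r (k : r.-tuple nat) (t : r.-tuple R) :
  \sum_(s : r.-tuple 'I_(val p)
         | [forall i, 0 < tnth s i]%N && sorted geq (map val s))
    polylog_term n k t s
  = word_sum r (polylog_star_component k t).
Proof.
rewrite big_mkcond; apply: eq_bigr => s _.
rewrite polylog_termE /polylog_star_component /positive_word -forallb_tnth sorted_map.
by case: ifP => _; rewrite ?mul1r ?mul0r.
Qed.

(** In reversed order, nonincreasing becomes nondecreasing, which is the
    complement of the strict descent required of the other factor; this is the
    form to which [alternating_cuts] applies. *)
Lemma polylog_star_component_rev k t s : size k = size s -> size t = size s ->
  polylog_star_component (rev k) (rev t) (rev s)
  = (positive_word s && sorted (fun x y => ~~ descends x y) s)%:R
    * word_weight k t s.
Proof.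
move=> ks ts; rewrite /polylog_star_component word_weight_rev //.
rewrite /positive_word all_rev rev_sorted; congr ((_ && _)%:R * _).
by apply: eq_sorted => x y /=; rewrite leqNgt.
Qed.

(** After both sums are merged into a single sum over words of length [m], the
    weight of the word factors out and the signed cuts remain.  The length
    [minn j m] is the one that the tuple type of [take j k] records. *)
Lemma polylog_component_relation m (k : m.-tuple nat) (t : m.-tuple R) :
  (0 < m)%N ->
  \sum_(0 <= j < m.+1)
    (-1) ^+ j * word_sum (minn j m) (polylog_component (take j k) (take j t))
      * word_sum (m - j) (polylog_star_component (rev (drop j k)) (rev (drop j t)))
  = 0.
Proof.
move=> m0.
transitivity (\sum_(0 <= j < m.+1) word_sum m (fun s =>
    (positive_word s)%:R * word_weight k t s *
    ((-1) ^+ j * (sorted descends (take j s)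
      && sorted (fun x y => ~~ descends x y) (drop j s))%:R))).
  apply: eq_big_nat => j /andP[_]; rewrite ltnS => jm.
  rewrite (minn_idPl jm) (word_sum_rev (m - j)) -mulrA word_sumM subnKC //.
  rewrite [LHS]mulr_sumr; apply: eq_bigr => s _ /=.
  rewrite polylog_star_component_rev ?size_drop ?size_tuple //.
  rewrite -(word_weight_cut j k t s) ?size_tuple //.
  have -> : positive_word s = positive_word (take j s) && positive_word (drop j s).
    by rewrite /positive_word -all_cat cat_take_drop.
  rewrite /polylog_component /= -!mulnb !natrM mulrACA.
  rewrite (mulrACA (positive_word _)%:R) [RHS]mulrCA; congr (_ * _); exact: mulrAC.
rewrite /word_sum exchange_big /=; apply: big1 => s _.
rewrite -mulr_sumr.
by have := alternating_cuts descends S s; rewrite size_tuple => ->; rewrite ?mulr0.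
Qed.

End Components.

Section Projection.
Context {T : Type} (Q : T -> comPzRingType) (p : T).

Definition dprod_proj (a : dprodRing Q) : Q p := a p.

HB.instance Definition _ := GRing.isZmodMorphism.Build (dprodRing Q) (Q p)
  dprod_proj (fun _ _ => erefl).
HB.instance Definition _ := GRing.isMonoidMorphism.Build (dprodRing Q) (Q p)
  dprod_proj (conj erefl (fun _ _ => erefl)).

End Projection.

(** Passing to the quotient by the direct sum and taking the component at [p] are
    both ring homomorphisms, so the relation follows from its components. *)
Lemma fpolylog_relation (n m : nat) (R : comPzRingType)
    (k : m.-tuple nat) (t : m.-tuple R) : (0 < m)%N ->
  \sum_(0 <= j < m.+1)
    (-1) ^+ j * fpolylog n [tuple of take j k] [tuple of take j t]
      * fpolylog_star n [tuple of rev (drop j k)] [tuple of rev (drop j t)]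
  = 0.
Proof.
move=> m0; rewrite /fpolylog /fpolylog_star /classA.
under eq_bigr => j _ do
  rewrite -(rmorph_sign (quot_proj (dsum_ideal (modpn n R)))) -!rmorphM.
rewrite -rmorph_sum -[RHS](rmorph0 (quot_proj (dsum_ideal (modpn n R)))).
congr quot_proj; apply: functional_extensionality_dep => p.
rewrite -[LHS]/(dprod_proj (modpn n R) p _) rmorph_sum.
rewrite -[RHS](polylog_component_relation n R p m k t) //.
apply: eq_bigr => j _; rewrite !rmorphM rmorph_sign.
congr (_ * _ * _); first exact: polylog_componentE.
exact: polylog_star_componentE.
Qed.

Theorem theorem3p15 (n m : nat) (k : m.-tuple nat)
  (hn : (0 < n)%N) (hm : (0 < m)%N) (hk : forall i : 'I_m, (0 < tnth k i)%N) :
  let t : m.-tuple {mpoly int[m]} := [tuple 'X_i | i < m] in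
  \sum_(0 <= j < m.+1)
    (-1) ^+ j * fpolylog n [tuple of take j k] [tuple of take j t]
      * fpolylog_star n [tuple of rev (drop j k)] [tuple of rev (drop j t)]
  = 0 :> calA n {mpoly int[m]}.
Proof. exact: fpolylog_relation. Qed.
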